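(* Let $n\in\mathbb N_{>0}$, $p\ge 1$, let $(\Xi_k,\rho_k)$, $k\in\{1,\ldots,n\}$, be metric spaces, let $\Xi:=\Xi_1\times\cdots\times\Xi_n$, and let $\rho$ be a metric on $\Xi$ that makes $\Xi$ a Polish space and that is equivalent to the product metric $\big(\sum_{k=1}^n\rho_k^q\big)^{1/q}$ for some $q\in[1,+\infty]$. Assume that the reference distribution $Q\in\mathcal P(\Xi)$ has a finite $p$th moment, and let $\bm\varepsilon=(\varepsilon_1,\ldots,\varepsilon_n)$ with $\varepsilon_k>0$ for all $k$. Let $h:\Xi\to\mathbb R$ be Borel measurable with $\mathbb E_Q[h]$ finite. Then the worst-case expectation $$\sup_{P\in\mathcal T_p(Q,\bm\varepsilon)}\mathbb E_P[h(\xi)]$$ is finite if and only if $h\in\mathcal G_p^{\rm up}$.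
   Context: Equivalence of $\rho$ and the product metric $\rho_{\rm prod}$ means that there are constants $0<c\le C$ with $c\,\rho_{\rm prod}\le\rho\le C\rho_{\rm prod}$ (for $q=\infty$ the product metric is $\max_k\rho_k$). $\mathcal P(\Xi)$ is the set of Borel probability measures on $\Xi$; $P$ has finite $p$th moment if $\int_\Xi\rho(\zeta,\xi)^p\,dP(\xi)<\infty$ for some $\zeta\in\Xi$. The multi-transport hyperrectangle (MTH) is $$\mathcal T_p(Q,\bm\varepsilon):=\Big\{\mathrm{pr}_{2\#}\pi:\ \pi\in\mathcal P(\Xi\times\Xi),\ \mathrm{pr}_{1\#}\pi=Q,\ \int_{\Xi\times\Xi}\rho_k(\zeta_k,\xi_k)^p\,d\pi(\zeta,\xi)\le\varepsilon_k^p\ \text{for all }k\in\{1,\ldots,n\}\Big\},$$ where $\mathrm{pr}_{1\#}\pi,\mathrm{pr}_{2\#}\pi$ are the first and second marginals of $\pi$. The class $\mathcal G_r^{\rm up}$ consists of all real-valued functions $h$ on $\Xi$ for which there are $C>0$ and $\zeta\in\Xi$ with $h(\xi)\le C(1+\rho(\zeta,\xi)^r)$ for all $\xi\in\Xi$. Expectations are $\mathbb E_P[h]=\mathbb E_P[h_+]-\mathbb E_P[(-h)_+]$, with the convention $\infty-\infty:=-\infty$. *)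

(* Defs.v *)
From HB Require Import structures.
From mathcomp Require Import all_boot all_order all_algebra.
From mathcomp Require Import all_classical all_reals all_analysis.

Set Implicit Arguments.
Unset Strict Implicit.
Unset Printing Implicit Defensive.
Import Order.TTheory GRing.Theory Num.Theory.
Import numFieldNormedType.Exports.
Local Open Scope classical_set_scope.
Local Open Scope ring_scope.

(* Nonempty metric spaces. The library's measurable types are pointed; the
   distinguished point plays no role beyond nonemptiness, which any space
   carrying a probability measure has. *)
#[short(type="pmetricType")]
HB.structure Definition PointedMetric (K : numDomainType) :=
  {M of Metric K M & isPointed M}.

Section metrics.
Context {R : realType}.

(* A metric as a bundled function, so that one type can carry several. *)
Record metric (T : Type) := MkMetric {
  dist :> T -> T -> R ;
  distxx : forall x, dist x x = 0 ;
  dist_positivity : forall x y, dist x y = 0 -> x = y ;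
  dist_sym : forall x y, dist x y = dist y x ;
  dist_triangle : forall y x z, dist x z <= dist x y + dist y z
}.

(* The carrier T with the metric d and the topology and uniformity induced
   by d, whatever topology T itself may have. *)
Definition metrized (T : Type) (d : metric T) : Type := T.

HB.instance Definition _ (T : pointedType) (d : metric T) :=
  Pointed.on (metrized d).
HB.instance Definition _ (T : pointedType) (d : metric T) :=
  @isMetric.Build R (metrized d) (dist d) (distxx d) (@dist_positivity T d)
    (dist_sym d) (dist_triangle d).

Definition metric_equiv (T : Type) (d d' : T -> T -> R) : Prop :=
  exists c C : R, [/\ 0 < c, c <= C &
    forall x y, c * d' x y <= d x y /\ d x y <= C * d' x y].

Definition complete_metric (T : pointedType) (d : metric T) : Prop :=
  forall F : set_system (metrized d), ProperFilter F -> cauchy F -> cvg F.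

Definition separable (T : topologicalType) : Prop :=
  exists2 S : set T, countable S & dense S.

Definition completely_metrizable (T : ptopologicalType) : Prop :=
  exists2 d : metric T, complete_metric d &
    (@open (metrized d) : set (set T)) = @open T.

Definition polish (T : ptopologicalType) : Prop :=
  separable T /\ completely_metrizable T.

End metrics.
Arguments metric R T : clear implicits.
Arguments completely_metrizable R T : clear implicits.
Arguments polish R T : clear implicits.

(* The library leaves this join undeclared. *)
HB.instance Definition _ (T U : ptopologicalType) :=
  Topological.on (T * U)%type.

Definition borel (T : ptopologicalType) :
    measurableType (sigma_display (@open T)) :=
  g_sigma_algebraType (@open T).
Arguments borel T%_type_scope.

Section product_metric.
Context {R : realType} {n : nat} (Xi : 'I_n -> pmetricType R).

(* The value at q = -oo is irrelevant: q is always assumed to be >= 1. *)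
Definition product_metric (q : \bar R) (x y : forall k, Xi k) : R :=
  if q is r%:E then (\sum_(k < n) mdist (x k) (y k) `^ r) `^ r^-1
  else \big[Num.max/0]_(k < n) mdist (x k) (y k).

End product_metric.
Arguments product_metric {R n} Xi q x y.

Section transport.
Context {R : realType} {n : nat} (Xi : 'I_n -> pmetricType R)
  (rho : metric R (forall k, Xi k)).
Local Notation X := (metrized rho).

Definition finite_moment (p : R) (Q : probability (borel X) R) : Prop :=
  exists z : X, (\int[Q]_x ((rho z x `^ p)%:E) < +oo)%E.

(* The coupling pi is a Borel probability for the product topology of X * X. *)
Definition MTH (p : R) (Q : probability (borel X) R) (eps : 'I_n -> R) :
    set (probability (borel X) R) :=
  [set P : probability (borel X) R | exists pi : probability (borel (X * X)%type) R,
    [/\ forall A : set (borel X), measurable A ->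
          pushforward pi (fst : borel (X * X)%type -> borel X) A = Q A,
        forall A : set (borel X), measurable A ->
          pushforward pi (snd : borel (X * X)%type -> borel X) A = P A &
        forall k : 'I_n,
          (\int[pi]_z ((mdist (z.1 k : Xi k) (z.2 k) `^ p)%:E)
             <= (eps k `^ p)%:E)%E]].

Definition G_up (r : R) : set (X -> R) :=
  [set h | exists (C : R) (z : X), 0 < C /\
     forall x : X, h x <= C * (1 + rho z x `^ r)].

(* The integral of the library is int h^+ - int h^-, and subtraction in \bar R
   satisfies +oo - +oo = -oo, which is the convention needed here. *)
Definition worst_case_expectation (p : R) (Q : probability (borel X) R)
    (eps : 'I_n -> R) (h : X -> R) : \bar R :=
  ereal_sup [set 'E_P[h] | P in MTH p Q eps]%E.

End transport.
Arguments finite_moment {R n Xi} rho p Q.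
Arguments MTH {R n Xi} rho p Q eps.
Arguments G_up {R n Xi} rho r.
Arguments worst_case_expectation {R n Xi} rho p Q eps h.

(* Main.v *)
Require Import Defs.
From HB Require Import structures.
From mathcomp Require Import all_boot all_order all_algebra.
From mathcomp Require Import all_classical all_reals all_analysis.
From mathcomp Require Import measurable_realfun lra.
Import Order.TTheory GRing.Theory Num.Theory.
Import numFieldNormedType.Exports.
Local Open Scope classical_set_scope.
Local Open Scope ring_scope.

(* If [h] has growth of order [p], the triangle inequality and the equivalence
   of metrics bound [rho z y ^ p] by a multiple of
   [rho z x ^ p + \sum_k rho_k (x k) (y k) ^ p]; integrating against a coupling
   bounds the [p]-th moments, hence the expectations of [h], uniformly over the
   hyperrectangle.  Conversely, for every [x] the mixture
   [(1 - b) Q + b \d_x] lies in the hyperrectangle when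
   [b = c / (1 + rho z x ^ p)] with [c] small and independent of [x]: transport
   the fraction [b] of the mass of [Q] to [x].  Its expectation is
   [(1 - b) E_Q h + b h x], so a finite supremum forces
   [h x <= C (1 + rho z x ^ p)]. *)

(** * Elementary inequalities between powers and finite sums *)

Section power_inequalities.
Context {R : realType}.
Implicit Types p r x y : R.

(** A sum is at most twice its larger term. This crude constant avoids convexity and covers every
    [p >= 0]. *)
Lemma powRD_le p x y : 0 <= p -> 0 <= x -> 0 <= y ->
  (x + y) `^ p <= 2 `^ p * (x `^ p + y `^ p).
Proof.
move=> p0.
wlog xy : x y / x <= y => [wlg x0 y0|x0 y0].
  have [/wlg|/ltW/wlg] := leP x y; first exact.
  by rewrite addrC [_ `^ p + _]addrC; exact.
apply: (@le_trans _ _ ((2 * y) `^ p)).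
  by apply: ge0_ler_powR => //; rewrite ?nnegrE; lra.
by rewrite powRM// ler_wpM2l ?powR_ge0// lerDr powR_ge0.
Qed.

Context (I : finType).

Lemma le_powR_sum p (c : I -> R) i : 1 <= p -> (forall j, 0 <= c j) ->
  c i <= (\sum_j c j `^ p) `^ p^-1.
Proof.
move=> p1 c0; have p0 : 0 < p by lra.
rewrite -[leLHS](@powRr1 _ (c i))// -(@mulfV _ p) ?gt_eqF// powRrM.
apply: ge0_ler_powR; rewrite ?nnegrE ?invr_ge0 ?powR_ge0//.
- exact: ltW.
- by apply: sumr_ge0 => j _; rewrite powR_ge0.
- by rewrite (bigD1 i)//= lerDl sumr_ge0// => j _; rewrite powR_ge0.
Qed.

(** Each [c i] is at most the l^p norm of [c], so the sum is at most [#|I|] times that norm; then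
    raise to the power [p]. *)
Lemma powR_sum_le p (c : I -> R) : 1 <= p -> (forall j, 0 <= c j) ->
  (\sum_j c j) `^ p <= #|I|%:R `^ p * \sum_j c j `^ p.
Proof.
move=> p1 c0; have p0 : 0 < p by lra.
have S0 : 0 <= \sum_j c j `^ p by apply: sumr_ge0 => j _; rewrite powR_ge0.
rewrite -[leRHS](_ : (#|I|%:R * (\sum_j c j `^ p) `^ p^-1) `^ p = _); last first.
  by rewrite powRM ?powR_ge0// -powRrM mulVf ?gt_eqF// powRr1.
apply: ge0_ler_powR; rewrite ?nnegrE ?mulr_ge0 ?powR_ge0 ?sumr_ge0//.
  exact: ltW.
rewrite mulr_natl -sumr_const; apply: ler_sum => i _; exact: le_powR_sum.
Qed.

(** Each [c j] is at most the whole sum, so the [r]-th powers add up to at most [#|I|] times the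
    [r]-th power of the sum. *)
Lemma powR_sum_root_le r (c : I -> R) : 1 <= r -> (forall j, 0 <= c j) ->
  (\sum_j c j `^ r) `^ r^-1 <= #|I|%:R * \sum_j c j.
Proof.
move=> r1 c0; have r0 : 0 < r by lra.
have S0 : 0 <= \sum_j c j by apply: sumr_ge0.
have -> : #|I|%:R * \sum_j c j = ((#|I|%:R * \sum_j c j) `^ r) `^ r^-1.
  by rewrite -powRrM mulfV ?gt_eqF// powRr1// mulr_ge0.
apply: ge0_ler_powR; rewrite ?nnegrE ?invr_ge0 ?powR_ge0//.
- exact: ltW.
- by apply: sumr_ge0 => j _; rewrite powR_ge0.
apply: (@le_trans _ _ (#|I|%:R * (\sum_j c j) `^ r)).
  rewrite mulr_natl -sumr_const; apply: ler_sum => i _.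
  apply: ge0_ler_powR; rewrite ?nnegrE//; first exact: ltW.
  by rewrite (bigD1 i)//= lerDl sumr_ge0.
rewrite powRM// ler_wpM2r ?powR_ge0//.
(* It remains to see [#|I| <= #|I| ^ r]: monotonicity in the exponent needs a base of at least 1, so
   the empty case is separate. *)
have [->|n0] := posnP #|I|; first by rewrite powR_ge0.
by rewrite -[leLHS]powRr1// ler_powR// ler1n.
Qed.

End power_inequalities.

(** * Comparison of the metric with the coordinate metrics *)

Lemma metric_ge0 {R : realType} {T : Type} (d : metric R T) x y : 0 <= d x y.
Proof.
have := dist_triangle d y x x; rewrite distxx [d y x]dist_sym; lra.
Qed.

Section product_metric_bounds.
Context {R : realType} {n : nat} {Xi : 'I_n -> pmetricType R}.
Implicit Types (q : \bar R) (x y : forall k, Xi k).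

Lemma mdist_le_product_metric q x y k : (1 <= q)%E ->
  mdist (x k) (y k) <= product_metric Xi q x y.
Proof.
case: q => [r| |]//=.
- rewrite lee_fin => r1.
  by apply: (@le_powR_sum _ _ r (fun k => mdist (x k) (y k))) => // j;
    rewrite mdist_ge0.
- move=> _.
  exact: (@le_bigmax_cond _ _ _ _ k xpredT (fun k => mdist (x k) (y k))).
Qed.

Lemma product_metric_le_sum q x y : (1 <= q)%E ->
  product_metric Xi q x y <= n%:R * \sum_k mdist (x k) (y k).
Proof.
case: q => [r| |]//=.
- rewrite lee_fin => r1.
  have := @powR_sum_root_le _ 'I_n r (fun k => mdist (x k) (y k)) r1.
  by rewrite card_ord; apply => ?; rewrite mdist_ge0.
- move=> _; apply/bigmax_leP; split=> [|k _].
    by rewrite mulr_ge0// sumr_ge0// => k _; rewrite mdist_ge0.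
  have n1 : 1 <= n%:R :> R by rewrite ler1n (leq_trans _ (ltn_ord k)).
  have S0 : mdist (x k) (y k) <= \sum_k mdist (x k) (y k).
    by rewrite (bigD1 k)//= lerDl sumr_ge0// => j _; rewrite mdist_ge0.
  by rewrite (le_trans S0)// ler_peMl// (le_trans _ S0)// mdist_ge0.
Qed.

(** Eliminates [q]: the later estimates use the equivalence of metrics only through these two
    bounds. [K] adds the constants of both directions so that one number serves for each. *)
Lemma product_metric_equivW (rho : metric R (forall k, Xi k)) q :
  (1 <= q)%E -> metric_equiv rho (product_metric Xi q) ->
  exists K : R, [/\ 0 < K,
    forall k x y, mdist (x k) (y k) <= K * rho x y &
    forall x y, rho x y <= K * \sum_k mdist (x k) (y k)].
Proof.
move=> q1 [c [C [c0 cC crho]]]; exists (c^-1 + C * n%:R).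
have ci0 : 0 < c^-1 by rewrite invr_gt0.
have C0 : 0 < C by exact: lt_le_trans cC.
have Cn0 : 0 <= C * n%:R by rewrite mulr_ge0// ltW.
split=> [|k x y|x y]; first lra.
- have [lo _] := crho x y.
  have le1 := @mdist_le_product_metric q x y k q1.
  have le2 : mdist (x k) (y k) <= c^-1 * rho x y.
    by rewrite (le_trans le1)// mulrC ler_pdivlMr// mulrC.
  by rewrite (le_trans le2)// ler_wpM2r ?metric_ge0//; lra.
- have [_ hi] := crho x y; rewrite (le_trans hi)//.
  rewrite (le_trans (ler_wpM2l (ltW C0) (product_metric_le_sum q x y q1)))//.
  rewrite mulrA ler_wpM2r//; last lra.
  by rewrite sumr_ge0// => j _; rewrite mdist_ge0.
Qed.

End product_metric_bounds.

(** * Borel measurability from continuity *)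

Lemma continuous_borel_measurable {T U : ptopologicalType} (f : T -> U) :
  continuous f -> measurable_fun [set: borel T] (f : borel T -> borel U).
Proof.
move=> /continuousP cf.
apply: (@measurability _ _ (borel T) (borel U) setT f (@open U) erefl).
by move=> _ [A oA <-]; rewrite setTI; apply: sub_sigma_algebra; exact: cf.
Qed.

(** Real values are treated apart because [R] carries its own measurable structure rather than
    [borel R]; open intervals serve as generators. *)
Lemma continuous_borel_measurableR {R : realType} {T : ptopologicalType}
    (f : T -> R) :
  continuous f -> measurable_fun [set: borel T] (f : borel T -> R).
Proof.
move=> /continuousP cf; apply: (measurability _ (RGenOpens.measurableE R)).
move=> _ [_ [a [b ->] <-]]; rewrite setTI; apply: sub_sigma_algebra.
exact/cf/interval_open.
Qed.

(** Phrased with balls so that it also applies to [X * X], whose balls are products of balls. *)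
Lemma lipschitz_ball_continuous {R : realType} {M : pseudoMetricType R}
    (K : R) (f : M -> R) : 0 < K ->
  (forall x y e, 0 < e -> ball x e y -> `|f x - f y| <= K * e) -> continuous f.
Proof.
move=> K0 fK x; apply/cvgrPdist_le => e e0.
have eK0 : 0 < e / K by rewrite divr_gt0.
near=> y; have xy : ball x (e / K) y by near: y; exact: nbhsx_ballx.
by rewrite (le_trans (fK _ _ _ eK0 xy))// mulrCA divff ?mulr1// gt_eqF.
Unshelve. all: by end_near.
Qed.

(** * Convex combinations of two probability measures *)

Section mixture.
Context d (T : measurableType d) {R : realType}.
Variables (P1 P2 : probability T R) (a b : {nonneg R}).
Hypothesis ab : a%:num + b%:num = 1.

(** The equation on the weights is an argument so that the total mass 1 can be attached to the term
    as a canonical instance. *)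
Definition mixture of a%:num + b%:num = 1 : set T -> \bar R :=
  measure_add (mscale a P1) (mscale b P2).

HB.instance Definition _ := Measure.copy (mixture ab)
  (measure_add (mscale a P1) (mscale b P2)).

Lemma mixture_setT : mixture ab setT = 1%E.
Proof.
rewrite /mixture measure_addE/= /mscale/= [P1 _]probability_setT.
by rewrite [P2 _]probability_setT !mule1 -EFinD ab.
Qed.

HB.instance Definition _ :=
  Measure_isProbability.Build _ _ _ (mixture ab) mixture_setT.

Lemma ge0_integral_mixture (f : T -> \bar R) :
  measurable_fun setT f -> (forall x, 0 <= f x)%E ->
  (\int[mixture ab]_x f x =
   a%:num%:E * \int[P1]_x f x + b%:num%:E * \int[P2]_x f x)%E.
Proof.
move=> mf f0; rewrite ge0_integral_measure_add//.
by rewrite !ge0_integral_mscale.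
Qed.

End mixture.
Arguments mixture {d T R} P1 P2 {a b} ab.

Lemma mixtureE d (T : measurableType d) {R : realType}
    (P1 P2 : probability T R) (a b : {nonneg R}) (ab : a%:num + b%:num = 1) A :
  mixture P1 P2 ab A = (a%:num%:E * P1 A + b%:num%:E * P2 A)%E.
Proof. by rewrite /mixture measure_addE. Qed.

Lemma integral_mixture d (T : measurableType d) {R : realType}
    (P1 P2 : probability T R) (a b : {nonneg R}) (ab : a%:num + b%:num = 1)
    (f : T -> \bar R) :
  P1.-integrable setT f -> P2.-integrable setT f ->
  (\int[mixture P1 P2 ab]_x f x =
   a%:num%:E * \int[P1]_x f x + b%:num%:E * \int[P2]_x f x)%E.
Proof.
move=> i1 i2; have mf := measurable_int _ i1.
have mp := measurable_funepos mf; have mn := measurable_funeneg mf.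
rewrite integralE !ge0_integral_mixture//.
rewrite (integralE P1 _ f) (integralE P2 _ f).
move: (integrable_pos_fin_num measurableT i1)
  (integrable_neg_fin_num measurableT i1)
  (integrable_pos_fin_num measurableT i2)
  (integrable_neg_fin_num measurableT i2).
(* Integrability makes all four integrals of positive and negative parts finite, so the
   rearrangement takes place in [R]. *)
do 4 move=> /fineK <-.
by rewrite -!EFinM -!EFinD; congr (_%:E); lra.
Qed.

Lemma expectation_mixture_dirac d (T : measurableType d) {R : realType}
    (P : probability T R) (x : T) (a b : {nonneg R})
    (ab : a%:num + b%:num = 1) (h : T -> R) :
  measurable_fun setT h -> ('E_P[h] \is a fin_num)%E ->
  ('E_(mixture P (@dirac _ T x R) ab)[h] =
   (a%:num * fine 'E_P[h] + b%:num * h x)%:E)%E.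
Proof.
move=> mh; rewrite unlock => fin.
have mEh : measurable_fun setT (EFin \o h) by exact/measurable_EFinP.
(* Since [+oo - +oo = -oo], a finite expectation forces both parts of [h] to have finite
   integrals. *)
have iP : P.-integrable setT (EFin \o h).
  by apply/integrableP; split => //; rewrite integral_fin_num_abs.
have id : (@dirac _ T x R).-integrable setT (EFin \o h).
  apply/integrableP; split => //=.
  by rewrite integral_fin_num_abs// integral_dirac// diracT mul1e.
rewrite integral_mixture// integral_dirac// diracT mul1e.
by rewrite EFinD !EFinM fineK.
Qed.

(** Supplies the bundled function that [distribution] expects. *)
Lemma mfun_ex {d d'} {T : measurableType d} {U : measurableType d'} (f : T -> U) :
  measurable_fun setT f -> exists g : {mfun T >-> U}, g = f :> (T -> U).
Proof. by move=> mf; exists (mfun_Sub (mem_set mf)). Qed.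

(** * Measurability of the distances and of the maps between [X] and [X * X] *)

Section transport_cost.
Context {R : realType} {n : nat} {Xi : 'I_n -> pmetricType R}.
Variable rho : metric R (forall k, Xi k).
Local Notation X := (metrized rho).

Lemma borel_measurable_metric (z : X) :
  measurable_fun [set: borel X] (rho z : borel X -> R).
Proof.
apply: (@continuous_borel_measurableR _ X).
apply: (@lipschitz_ball_continuous _ _ 1) => // x y e e0.
rewrite ballEmdist/= mul1r => /ltW xy; rewrite (le_trans _ xy)//.
have xyE : mdist x y = rho x y by [].
have := dist_triangle rho y z x; have := dist_triangle rho x z y.
rewrite [rho y x]dist_sym xyE ler_norml; lra.
Qed.

Lemma borel_measurable_fst : measurable_fun [set: borel (X * X)]
  (fst : borel (X * X) -> borel X).
Proof.
apply: (@continuous_borel_measurable (X * X)%type X) => x; exact: cvg_fst.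
Qed.

Lemma borel_measurable_snd : measurable_fun [set: borel (X * X)]
  (snd : borel (X * X) -> borel X).
Proof.
apply: (@continuous_borel_measurable (X * X)%type X) => x; exact: cvg_snd.
Qed.

Lemma borel_measurable_pair_cst (y : X) : measurable_fun [set: borel X]
  ((fun x => (x, y)) : borel X -> borel (X * X)).
Proof.
apply: (@continuous_borel_measurable X (X * X)%type) => x.
exact: (@cvg_pair _ _ _ (nbhs (x : X)) (nbhs (x : X)) (nbhs (y : X)) _ _ _
  id (cst y) cvg_id (cvg_cst _)).
Qed.

Lemma borel_measurable_diag : measurable_fun [set: borel X]
  ((fun x => (x, x)) : borel X -> borel (X * X)).
Proof.
apply: (@continuous_borel_measurable X (X * X)%type) => x.
exact: (@cvg_pair _ _ _ (nbhs (x : X)) (nbhs (x : X)) (nbhs (x : X)) _ _ _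
  id id cvg_id cvg_id).
Qed.

Variable K : R.
Hypotheses (K0 : 0 < K)
  (mdist_rho : forall k x y, mdist (x k) (y k) <= K * rho x y).

(** By [mdist_rho] and the triangle inequality, moving each of the two points by [e] changes the
    cost by at most [K * e], hence the Lipschitz constant [2 * K]. *)
Lemma borel_measurable_coord_cost k : measurable_fun [set: borel (X * X)]
  ((fun w => mdist (w.1 k : Xi k) (w.2 k)) : borel (X * X) -> R).
Proof.
apply: (@continuous_borel_measurableR _ (X * X)%type).
apply: (@lipschitz_ball_continuous _ (X * X)%type (2 * K)).
  by rewrite mulr_gt0.
move=> -[x1 x2] [y1 y2] e e0 [/=]; rewrite !ballEmdist/=.
have E x y : mdist (x : X) y = rho x y by [].
rewrite !E => xy1 xy2.
have := metric_triangle (x1 k) (y1 k) (x2 k).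
have := metric_triangle (y1 k) (y2 k) (x2 k).
have := metric_triangle (y1 k) (x1 k) (y2 k).
have := metric_triangle (x1 k) (x2 k) (y2 k).
have := mdist_rho k x1 y1; have := mdist_rho k x2 y2.
rewrite (metric_sym (y1 k) (x1 k)) (metric_sym (y2 k) (x2 k)).
have := ler_wpM2l (ltW K0) (ltW xy1); have := ler_wpM2l (ltW K0) (ltW xy2).
rewrite ler_norml => *; apply/andP; split; lra.
Qed.

End transport_cost.

(** * Uniform moment and expectation bounds over the hyperrectangle *)

Section bounds.
Context {R : realType} {n : nat} {Xi : 'I_n -> pmetricType R}.
Variable rho : metric R (forall k, Xi k).
Local Notation X := (metrized rho).
Variables (p K : R).
Hypotheses (p1 : 1 <= p) (K0 : 0 < K)
  (mdist_rho : forall k x y, mdist (x k) (y k) <= K * rho x y)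
  (rho_mdist : forall x y, rho x y <= K * \sum_k mdist (x k) (y k)).

Let p0 : 0 <= p. Proof. exact: le_trans ler01 p1. Qed.

Lemma cost_triangle : exists2 L : R, 0 < L & forall z x y : X,
  rho z y `^ p <= L * (rho z x `^ p + \sum_k mdist (x k) (y k) `^ p).
Proof.
(* The factor [2 ^ p] splits the power of [rho z x + K * S], and [K ^ p * n ^ p] bounds
   [(K * S) ^ p] by the sum of powers; adding 1 covers both summands at once. *)
have L0 : 0 < 1 + K `^ p * n%:R `^ p by rewrite ltr_wpDr// mulr_ge0 ?powR_ge0.
exists (2 `^ p * (1 + K `^ p * n%:R `^ p)); first by rewrite mulr_gt0 ?powR_gt0.
move=> z x y; set S := \sum_k mdist (x k) (y k).
have S0 : 0 <= S by apply: sumr_ge0 => k _; rewrite mdist_ge0.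
have r0 := metric_ge0 rho z x.
have tri : rho z y <= rho z x + K * S.
  by rewrite (le_trans (dist_triangle rho x z y))// lerD2l rho_mdist.
rewrite (@le_trans _ _ ((rho z x + K * S) `^ p))//.
  by apply: ge0_ler_powR; rewrite ?nnegrE ?addr_ge0 ?mulr_ge0 ?metric_ge0// ltW.
rewrite (le_trans (powRD_le _ _ _ p0 r0 _)) ?mulr_ge0 ?(ltW K0)//.
rewrite -mulrA ler_wpM2l ?powR_ge0// powRM ?(ltW K0)//.
have := powR_sum_le 'I_n p (fun k => mdist (x k) (y k)) p1
  (fun k => mdist_ge0 _ _).
rewrite card_ord -/S; set T := \sum_k _ => ST.
have T0 : 0 <= T by apply: sumr_ge0 => k _; rewrite powR_ge0.
have := ler_wpM2l (powR_ge0 K p) ST.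
rewrite mulrDl mul1r mulrDr mulrA => KST.
have : 0 <= K `^ p * n%:R `^ p * rho z x `^ p by rewrite !mulr_ge0 ?powR_ge0.
lra.
Qed.

Lemma borel_measurable_metric_pow (z : X) :
  measurable_fun [set: borel X] (fun x : borel X => ((rho z x) `^ p)%:E).
Proof.
apply/measurable_EFinP.
exact: measurableT_comp (measurable_powR p) (borel_measurable_metric rho z).
Qed.

Lemma borel_measurable_coord_cost_pow k : measurable_fun [set: borel (X * X)]
  (fun w : borel (X * X) => (mdist (w.1 k : Xi k) (w.2 k) `^ p)%:E).
Proof.
apply/measurable_EFinP.
exact: measurableT_comp (measurable_powR p)
  (borel_measurable_coord_cost rho K K0 mdist_rho k).
Qed.

(** The triangle inequality moves the base point from the one given by [finite_moment] to an
    arbitrary [z]. *)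
Lemma finite_moment_bound (Q : probability (borel X) R) (z : X) :
  finite_moment rho p Q ->
  exists2 M : R, 0 <= M & (\int[Q]_x ((rho z x `^ p)%:E) <= M%:E)%E.
Proof.
move=> [z0 fin0].
have I0 : (0 <= \int[Q]_x (rho z0 x `^ p)%:E)%E.
  by apply: integral_ge0 => x _; rewrite lee_fin powR_ge0.
have Ifin : (\int[Q]_x (rho z0 x `^ p)%:E)%E \is a fin_num.
  by rewrite ge0_fin_numE.
set m := fine (\int[Q]_x (rho z0 x `^ p)%:E)%E.
have m0 : 0 <= m by apply: fine_ge0.
exists (2 `^ p * (rho z z0 `^ p + m)).
  by rewrite mulr_ge0 ?addr_ge0 ?powR_ge0.
have mz := borel_measurable_metric_pow z.
have mz0 := borel_measurable_metric_pow z0.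
apply: (@le_trans _ _ (\int[Q]_x ((2 `^ p)%:E *
    ((rho z z0 `^ p)%:E + (rho z0 x `^ p)%:E)))%E).
  apply: ge0_le_integral => //.
  - by move=> x _; rewrite lee_fin powR_ge0.
  - apply: emeasurable_funM; first exact: measurable_cst.
    by apply: emeasurable_funD => //; exact: measurable_cst.
  - move=> x _; rewrite -EFinD -EFinM lee_fin.
    apply: le_trans
      (powRD_le _ _ _ p0 (metric_ge0 rho z z0) (metric_ge0 rho z0 x)).
    by apply: ge0_ler_powR; rewrite ?nnegrE ?addr_ge0 ?metric_ge0// dist_triangle.
rewrite ge0_integralZl//; first last.
- by move=> x _; rewrite -EFinD lee_fin addr_ge0 ?powR_ge0.
- by apply: emeasurable_funD => //; exact: measurable_cst.
rewrite ge0_integralD//; first last.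
- by move=> x _; rewrite lee_fin powR_ge0.
- by move=> x _; rewrite lee_fin powR_ge0.
rewrite integral_cst// [X in (_ * X + _)%E]probability_setT mule1.
by rewrite -(fineK Ifin) -EFinD -EFinM.
Qed.

Lemma MTH_moment_bound (Q : probability (borel X) R) (eps : 'I_n -> R) (z : X) :
  finite_moment rho p Q ->
  exists M : R, forall P, MTH rho p Q eps P ->
    (\int[P]_x ((rho z x `^ p)%:E) <= M%:E)%E.
Proof.
move=> /(finite_moment_bound _ z)[m m0 Qm].
have [L L0 costL] := cost_triangle.
exists (L * (m + \sum_k eps k `^ p)) => P [pi [pi1 pi2 cost]].
have [f1 f1E] := mfun_ex _ (borel_measurable_fst rho).
have [f2 f2E] := mfun_ex _ (borel_measurable_snd rho).
have mz := borel_measurable_metric_pow z.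
have z0 (x : borel X) : (0 <= (rho z x `^ p)%:E)%E by rewrite lee_fin powR_ge0.
(* Change of variables along the projections: the marginal conditions turn integrals over [pi] into
   integrals over [Q] and [P]. *)
have I1 : (\int[pi]_w (rho z w.1 `^ p)%:E = \int[Q]_x (rho z x `^ p)%:E)%E.
  transitivity (\int[distribution pi f1]_x (rho z x `^ p)%:E)%E.
    by rewrite ge0_integral_distribution//= f1E.
  apply: eq_measure_integral => A mA _.
  by apply: etrans (pi1 A mA); rewrite /= /distribution f1E.
have I2 : (\int[pi]_w (rho z w.2 `^ p)%:E = \int[P]_x (rho z x `^ p)%:E)%E.
  transitivity (\int[distribution pi f2]_x (rho z x `^ p)%:E)%E.
    by rewrite ge0_integral_distribution//= f2E.
  apply: eq_measure_integral => A mA _.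
  by apply: etrans (pi2 A mA); rewrite /= /distribution f2E.
have m1 : measurable_fun [set: borel (X * X)]
    (fun w : borel (X * X) => (rho z w.1 `^ p)%:E).
  exact: measurableT_comp mz (borel_measurable_fst rho).
have m2 : measurable_fun [set: borel (X * X)]
    (fun w : borel (X * X) => (rho z w.2 `^ p)%:E).
  exact: measurableT_comp mz (borel_measurable_snd rho).
have mk := borel_measurable_coord_cost_pow.
have msum : measurable_fun [set: borel (X * X)]
    (fun w : borel (X * X) => \sum_k (mdist (w.1 k : Xi k) (w.2 k) `^ p)%:E)%E.
  exact: emeasurable_sum.
have sum0 (w : borel (X * X)) :
    (0 <= \sum_k (mdist (w.1 k : Xi k) (w.2 k) `^ p)%:E)%E.
  by apply: sume_ge0 => k _; rewrite lee_fin powR_ge0.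
rewrite -I2.
apply: (@le_trans _ _ (\int[pi]_w (L%:E * ((rho z w.1 `^ p)%:E +
    \sum_k (mdist (w.1 k : Xi k) (w.2 k) `^ p)%:E)))%E).
  apply: ge0_le_integral => //.
  - apply: emeasurable_funM; first exact: measurable_cst.
    exact: emeasurable_funD.
  - by move=> w _; rewrite sumEFin -EFinD -EFinM lee_fin; exact: costL.
rewrite ge0_integralZl//; first last.
- by rewrite lee_fin ltW.
- by move=> w _; rewrite adde_ge0.
- exact: emeasurable_funD.
rewrite ge0_integralD//= I1 ge0_integral_sum//; last first.
  by move=> k w _; rewrite lee_fin powR_ge0.
rewrite EFinM lee_pmul2l ?lte_fin//.
rewrite EFinD leeD// -sumEFin; apply: lee_sum => k _; exact: cost.
Qed.

Lemma MTH_expectation_bound (Q : probability (borel X) R) (eps : 'I_n -> R)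
    (h : X -> R) :
  measurable_fun [set: borel X] (h : borel X -> R) ->
  finite_moment rho p Q -> G_up rho p h ->
  exists M : R, forall P, MTH rho p Q eps P -> ('E_P[h] <= M%:E)%E.
Proof.
move=> mh Qfin [C [z [C0 hC]]].
have [M PM] := MTH_moment_bound Q eps z Qfin.
exists (C * (1 + M)) => P /PM {}PM.
have mz := borel_measurable_metric_pow z.
have mEh : measurable_fun [set: borel X] (EFin \o (h : borel X -> R)).
  exact/measurable_EFinP.
have mr : measurable_fun [set: borel X]
    (fun x : borel X => 1 + (rho z x `^ p)%:E)%E.
  by apply: emeasurable_funD => //; exact: measurable_cst.
rewrite unlock integralE.
(* Dropping the negative part only increases the value, so no integrability of [h] under [P] is
   required. *)
apply: (@le_trans _ _ (\int[P]_x (EFin \o (h : borel X -> R))^\+ x)%E).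
  by rewrite -[leRHS]sube0 leeB// integral_ge0.
apply: (@le_trans _ _ (\int[P]_x (C%:E * (1 + (rho z x `^ p)%:E)))%E).
  apply: ge0_le_integral => //.
  - exact: measurable_funepos.
  - by apply: emeasurable_funM => //; exact: measurable_cst.
  - move=> x _; rewrite -EFinD -EFinM funeposE /= ge_max !lee_fin hC/=.
    by rewrite mulr_ge0 ?addr_ge0 ?powR_ge0// ltW.
rewrite ge0_integralZl//; first last.
- by rewrite lee_fin ltW.
- by move=> x _; rewrite -EFinD lee_fin addr_ge0 ?powR_ge0.
rewrite ge0_integralD//; first last.
- by move=> x _; rewrite lee_fin powR_ge0.
rewrite integral_cst// [X in (_ * X + _)%E]probability_setT mule1.
by rewrite EFinM EFinD lee_pmul2l ?lte_fin// leeD2l.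
Qed.

End bounds.

(** * Coupling [Q] with its mixture with a Dirac mass *)

Section dirac_coupling.
Context {R : realType} {n : nat} {Xi : 'I_n -> pmetricType R}.
Variable rho : metric R (forall k, Xi k).
Local Notation X := (metrized rho).
Variables (p K : R).
Hypotheses (p1 : 1 <= p) (K0 : 0 < K)
  (mdist_rho : forall k x y, mdist (x k) (y k) <= K * rho x y).

Lemma MTH_mixture_dirac (Q : probability (borel X) R) (eps : 'I_n -> R) (x : X)
    (a b : {nonneg R}) (ab : a%:num + b%:num = 1) :
  (forall k, b%:num%:E * \int[Q]_z (mdist (z k : Xi k) (x k) `^ p)%:E
     <= (eps k `^ p)%:E)%E ->
  MTH rho p Q eps (mixture Q (@dirac _ (borel X) x R) ab).
Proof.
move=> cost.
have [D DE] := mfun_ex _ (borel_measurable_diag rho).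
have [E EE] := mfun_ex _ (borel_measurable_pair_cst rho x).
(* The coupling keeps a point [z] at [(z, z)] with weight [a] and sends it to [(z, x)] with weight
   [b]. *)
exists (mixture (distribution Q D) (distribution Q E) ab); split.
- move=> A mA.
  transitivity (a%:num%:E * Q A + b%:num%:E * Q A)%E.
    apply: etrans; first exact: mixtureE.
    by rewrite /= /distribution DE EE.
  by rewrite -ge0_muleDl ?lee_fin// -EFinD ab mul1e.
- move=> A mA.
  apply: etrans; first exact: mixtureE.
  apply/esym; apply: etrans; first exact: mixtureE.
  apply/esym; rewrite /= /distribution /pushforward DE EE diracE.
  congr (_ + _ * _)%E.
  have [Ax|Ax] := boolP (x \in A).
    transitivity (Q setT); last exact: probability_setT.
    by congr (Q _); apply/seteqP; split => // z _; exact: set_mem.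
  transitivity (Q set0); last exact: measure0.
  congr (Q _); apply/seteqP; split => // z /= Axz.
  by move: Ax; rewrite mem_set.
- move=> k.
  have mk := borel_measurable_coord_cost_pow rho p K K0 mdist_rho k.
  have k0 (w : borel (X * X)) : (0 <= (mdist (w.1 k : Xi k) (w.2 k) `^ p)%:E)%E.
    by rewrite lee_fin powR_ge0.
  rewrite ge0_integral_mixture// !ge0_integral_distribution//= DE EE/=.
  (* The diagonal part costs nothing; [p] must be nonzero here because [0 ^ 0 = 1]. *)
  rewrite [X in (_ * X + _)%E]integral0_eq; last first.
    by move=> z _; rewrite mdistxx powR0// gt_eqF// (lt_le_trans ltr01 p1).
  by rewrite mule0 add0e; exact: cost.
Qed.

End dirac_coupling.

(** * A bounded worst case forces growth of order [p] *)

Section necessity.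
Context {R : realType} {n : nat} {Xi : 'I_n -> pmetricType R}.
Variable rho : metric R (forall k, Xi k).
Local Notation X := (metrized rho).
Variables (p K : R).
Hypotheses (p1 : 1 <= p) (K0 : 0 < K)
  (mdist_rho : forall k x y, mdist (x k) (y k) <= K * rho x y).

Let p0 : 0 <= p. Proof. exact: le_trans ler01 p1. Qed.

(** Sending all of [Q] to [x] goes through [z]. That [L] depends on neither [k] nor [x] allows one
    choice of weight for all targets. *)
Lemma dirac_cost_bound (Q : probability (borel X) R) (z : X) :
  finite_moment rho p Q ->
  exists2 L : R, 0 < L & forall k (x : X),
    (\int[Q]_y (mdist (y k : Xi k) (x k) `^ p)%:E
       <= (L * (1 + rho z x `^ p))%:E)%E.
Proof.
move=> /(finite_moment_bound _ _ p1 _ z)[m m0 Qm].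
have KP0 : 0 < K `^ p * 2 `^ p by rewrite mulr_gt0 ?powR_gt0.
exists (K `^ p * 2 `^ p * (m + 1)); first by rewrite mulr_gt0// ltr_wpDl.
move=> k x; have rx0 := powR_ge0 (rho z x) p.
have mz := borel_measurable_metric_pow rho p z.
have msum : measurable_fun [set: borel X]
    (fun y : borel X => (rho z y `^ p)%:E + (rho z x `^ p)%:E)%E.
  by apply: emeasurable_funD => //; exact: measurable_cst.
apply: (@le_trans _ _ (\int[Q]_y ((K `^ p * 2 `^ p)%:E *
    ((rho z y `^ p)%:E + (rho z x `^ p)%:E)))%E).
  apply: ge0_le_integral => //.
  - by move=> y _; rewrite lee_fin powR_ge0.
  - exact: measurableT_comp
      (borel_measurable_coord_cost_pow rho p K K0 mdist_rho k)
      (borel_measurable_pair_cst rho x).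
  - by apply: emeasurable_funM => //; exact: measurable_cst.
  - move=> y _; rewrite -EFinD -EFinM lee_fin.
    have tri := powRD_le _ _ _ p0 (metric_ge0 rho z y) (metric_ge0 rho z x).
    apply: (@le_trans _ _ ((K * (rho z y + rho z x)) `^ p)).
      apply: ge0_ler_powR; rewrite ?nnegrE ?mdist_ge0//.
        by rewrite mulr_ge0 ?addr_ge0 ?metric_ge0// ltW.
      rewrite (le_trans (mdist_rho k _ _))// ler_wpM2l ?(ltW K0)//.
      by rewrite [rho z y]dist_sym dist_triangle.
    by rewrite powRM ?addr_ge0 ?metric_ge0 ?(ltW K0)// -mulrA ler_wpM2l ?powR_ge0.
rewrite ge0_integralZl//; first last.
- by rewrite lee_fin ltW.
- by move=> y _; rewrite -EFinD lee_fin addr_ge0 ?powR_ge0.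
rewrite ge0_integralD//; first last.
- by move=> y _; rewrite lee_fin powR_ge0.
rewrite integral_cst// [X in (_ + _ * X)%E]probability_setT mule1.
rewrite -[X in (_ <= X%:E)%E]mulrA [X in (_ <= X)%E]EFinM lee_pmul2l ?lte_fin//.
apply: (@le_trans _ _ (m + rho z x `^ p)%:E); first by rewrite EFinD leeD2r.
(* The product [(m + 1) * (1 + rho z x ^ p)] exceeds [m + rho z x ^ p] by nonnegative terms. *)
have := mulr_ge0 m0 rx0; rewrite lee_fin; lra.
Qed.

Lemma G_up_of_bounded (Q : probability (borel X) R) (eps : 'I_n -> R)
    (h : X -> R) (M : R) :
  (forall k, 0 < eps k) -> finite_moment rho p Q ->
  measurable_fun [set: borel X] (h : borel X -> R) ->
  ('E_Q[h] \is a fin_num)%E ->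
  (forall P, MTH rho p Q eps P -> ('E_P[h] <= M%:E)%E) ->
  G_up rho p h.
Proof.
move=> eps0 Qfin mh fin hM; pose z : X := point.
have [L L0 costL] := dirac_cost_bound Q z Qfin.
pose S := \sum_k L / eps k `^ p.
have ep k : 0 < eps k `^ p by rewrite powR_gt0.
have S0 : 0 <= S by apply: sumr_ge0 => k _; rewrite ltW// divr_gt0.
(* [S] dominates every [L / eps k ^ p], so [c * L <= eps k ^ p] for all [k] at once; the added 1
   gives [c <= 1], so that [c / r] is a valid weight. *)
pose c := (1 + S)^-1.
have S1 : 0 < 1 + S by rewrite ltr_wpDr.
have c0 : 0 < c by rewrite invr_gt0.
have c1 : c <= 1 by rewrite invf_le1// lerDl.
have cL k : c * L <= eps k `^ p.
  rewrite mulrC ler_pdivrMr// mulrC -ler_pdivrMr//.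
  rewrite (@le_trans _ _ S) ?lerDr// /S (bigD1 k)//= lerDl.
  by apply: sumr_ge0 => j _; rewrite ltW// divr_gt0.
set e := fine 'E_Q[h]%E.
(* With [b = c / r], the bound [(1 - b) * e + b * h x <= M] gives [b * h x <= |M| + |e|]; the extra
   1 keeps the constant positive. *)
exists ((`|M| + `|e| + 1) / c), z; split=> [|x].
  by rewrite divr_gt0// ltr_wpDl// addr_ge0.
set r := 1 + rho z x `^ p.
have r1 : 1 <= r by rewrite lerDl powR_ge0.
have r0 : 0 < r by exact: lt_le_trans r1.
have b0 : 0 <= c / r by rewrite ltW// divr_gt0.
have b1 : c / r <= 1 by rewrite ler_pdivrMr// mul1r (le_trans c1).
have a0 : 0 <= 1 - c / r by rewrite subr_ge0.
have ab : (NngNum a0)%:num + (NngNum b0)%:num = 1 by rewrite /= subrK.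
have /hM : MTH rho p Q eps (mixture Q (@dirac _ (borel X) x R) ab).
  apply: (MTH_mixture_dirac rho p K p1 K0 mdist_rho) => k /=.
  apply: (@le_trans _ _ ((c / r)%:E * (L * r)%:E)%E).
    by apply: lee_wpmul2l; [rewrite lee_fin|exact: costL].
  rewrite -EFinM lee_fin mulrACA mulVf ?gt_eqF// mulr1; exact: cL.
rewrite expectation_mixture_dirac// -/e lee_fin/= => hMe.
rewrite -ler_pdivrMr// ler_pdivlMr// mulrC mulrA mulrAC.
have := ler_wpM2l a0 (ler_norm (- e)); rewrite normrN.
have := mulr_ge0 b0 (normr_ge0 e); have := ler_norm M.
move: hMe; lra.
Qed.

End necessity.

Theorem proposition4p2 (R : realType) (n : nat) (hn : (0 < n)%N)
  (p : R) (hp : 1 <= p)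
  (Xi : 'I_n -> pmetricType R)
  (rho : metric R (forall k, Xi k))
  (hpolish : polish R (metrized rho))
  (hequiv : exists2 q : \bar R, (1 <= q)%E &
     metric_equiv rho (product_metric Xi q))
  (Q : probability (borel (metrized rho)) R)
  (hQ : finite_moment rho p Q)
  (eps : 'I_n -> R) (heps : forall k, 0 < eps k)
  (h : metrized rho -> R)
  (hmeas : measurable_fun [set: borel (metrized rho)]
             (h : borel (metrized rho) -> R))
  (hint : ('E_Q[h] \is a fin_num)%E) :
  worst_case_expectation rho p Q eps h \is a fin_num <-> G_up rho p h.
Proof.
have [q q1 /(product_metric_equivW rho q q1)[K [K0 mdistK rhoK]]] := hequiv.
split=> [fin|hG].
  apply: (G_up_of_bounded rho p K hp K0 mdistK Q eps h
    (fine (worst_case_expectation rho p Q eps h))) => // P PM.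
  by rewrite fineK//; apply: ereal_sup_ubound; exists P.
have [M hM] :=
  MTH_expectation_bound rho p K hp K0 mdistK rhoK Q eps h hmeas hQ hG.
have ab : 1%:nng%:num + 0%:nng%:num = 1 :> R by rewrite /= addr0.
(* With weights 1 and 0 this is [Q] in the form of a Dirac mixture, so it lies in the
   hyperrectangle; its finite expectation keeps the supremum above [-oo]. *)
pose Q0 := mixture Q (@dirac _ (borel (metrized rho)) point R) ab.
have Q0E : MTH rho p Q eps Q0.
  apply: (MTH_mixture_dirac rho p K hp K0 mdistK) => k.
  by rewrite mul0e lee_fin powR_ge0.
rewrite fin_numE; apply/andP; split.
  rewrite gt_eqF// (@lt_le_trans _ _ ('E_Q0[h])%E)//.
    by rewrite expectation_mixture_dirac// ltNyr.
  by apply: ereal_sup_ubound; exists Q0.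
rewrite lt_eqF// (@le_lt_trans _ _ M%:E) ?ltry//.
by apply: ge_ereal_sup => _ [P /hM ? <-].
Qed.
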